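(* Let $\alpha$ be a constant with $2\le\alpha\le3$. Consider the following cost-sharing mechanism for $n$ players. Each player $i$ owns a job with true positive workload $w_i$ (declared truthfully) and a private true positive penalty $p_i$. Player $i$ declares some $\hat p_i>0$. The operator fixes a job order $\pi$ that does not depend on the declared penalties. Each job $j$ is processed in order $\pi$ for length $$\ell_j=w_j\left(\frac{\alpha-1}{\sum_{m:\pi(m)\ge\pi(j)}\hat p_m}\right)^{1/\alpha},$$ at speed $s_j=w_j/\ell_j$. The completion time of job $i$ is $C_i=\sum_{j:\pi(j)\le\pi(i)}\ell_j$. Let $OPT_\pi(\vec{\hat p})=\sum_j \ell_j s_j^\alpha$. Let $OPT_\pi(\vec{\hat p}_{-i})$ be the same quantity computed for the instance with player $i$ removed: the remaining jobs keep their relative order under $\pi$, and the lengths are recomputed by the same formula from the remaining declared penalties. Player $i$ is charged $$b_i=\alpha\bigl(OPT_\pi(\vec{\hat p})-OPT_\pi(\vec{\hat p}_{-i})\bigr)-\hat p_iC_i,$$ and player $i$'s cost is $p_iC_i+b_i$. Then the mechanism is truthful. That is, for every player $i$ and every fixed declarations of the other players, player $i$'s cost is minimized by declaring $\hat p_i=p_i$.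
   Context: The lengths $\ell_j$ are exactly those minimizing energy $\sum_j w_j^\alpha\ell_j^{1-\alpha}$ plus declared weighted completion time $\sum_j\hat p_jC_j$ for the fixed order $\pi$. *)

(* Defs.v *)
From HB Require Import structures.
From mathcomp Require Import all_boot all_order all_algebra all_fingroup.
From mathcomp Require Import all_classical all_reals all_analysis.

Set Implicit Arguments.
Unset Strict Implicit.
Unset Printing Implicit Defensive.

Import Order.TTheory GRing.Theory Num.Theory.
Local Open Scope ring_scope.

(* Workloads w and declared penalties q are indexed by the full player set 'I_n;
   sigma j is the position of job j in the processing order.  An instance is
   given by the set A of the players taking part, processed in the relative
   order induced by sigma: [set: 'I_n] is the full instance and [set~ i] is the
   instance with player i removed.  job_length and job_speed are only meaningful
   for jobs in A. *)
Section Mechanism.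
Variables (R : realType) (alpha : R) (n : nat).
Variables (w : 'I_n -> R) (sigma : 'S_n).
Implicit Types (A : {set 'I_n}) (p q : 'I_n -> R) (i j : 'I_n).

Definition job_length A q j : R :=
  w j * ((alpha - 1) / \sum_(m in A | (sigma j <= sigma m)%N) q m)
          `^ (alpha^-1).

Definition job_speed A q j : R := w j / job_length A q j.

Definition completion_time A q i : R :=
  \sum_(j in A | (sigma j <= sigma i)%N) job_length A q j.

(* Total energy of the schedule of A. *)
Definition OPT A q : R :=
  \sum_(j in A) job_length A q j * job_speed A q j `^ alpha.

Definition player_charge q i : R :=
  alpha * (OPT [set: 'I_n] q - OPT [set~ i] q)
    - q i * completion_time [set: 'I_n] q i.

(* p: true penalties, q: declared penalties. *)
Definition player_cost p q i : R :=
  p i * completion_time [set: 'I_n] q i + player_charge q i.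

End Mechanism.

(* Main.v *)
Require Import Defs.
From HB Require Import structures.
From mathcomp Require Import all_boot all_order all_algebra all_fingroup.
From mathcomp Require Import all_classical all_reals all_analysis.
From mathcomp Require Import ring lra.

Set Implicit Arguments.
Unset Strict Implicit.
Unset Printing Implicit Defensive.

Import Order.TTheory GRing.Theory Num.Theory.
Local Open Scope ring_scope.

(** Let [S_j] be the total declared penalty of the jobs from [j] on. The energy
    of job [j] is [l_j S_j / (alpha - 1)], so [alpha OPT] is the minimum, over
    all lengths, of energy plus declared weighted completion time, hence a sum
    of concave functions of the [S_j] with derivatives [l_j]. If player [i]
    declares [x] instead of [p_i], then [S_j] moves by [x - p_i] exactly for the
    jobs [j] not after [i]; as [C_i] is the sum of their lengths, the cost at
    [x] is, up to a constant, the value at [p_i] of the tangent at [x] to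
    [alpha OPT], which by concavity is at least [alpha OPT] at [p_i]. *)

Section JobEnergy.
Variables (R : realType) (alpha : R).
Hypothesis alpha_gt1 : 1 < alpha.
Let alpha_gt0 : 0 < alpha := lt_trans ltr01 alpha_gt1.

(** Young's inequality for the conjugate exponents [alpha] and [(1 - alpha^-1)^-1], multiplied by
    [alpha]. *)
Lemma weighted_AMGM (s t : R) : 0 <= s -> 0 <= t ->
  alpha * (s `^ alpha^-1 * t `^ (1 - alpha^-1)) <= s + (alpha - 1) * t.
Proof.
move=> s0 t0.
have b0 : 0 < 1 - alpha^-1 by rewrite subr_gt0 invf_lt1.
have := @conjugate_powR _ (s `^ alpha^-1) (t `^ (1 - alpha^-1))
  alpha (1 - alpha^-1)^-1 (powR_ge0 _ _) (powR_ge0 _ _) alpha_gt0.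
rewrite invr_gt0 b0 invrK addrC subrK => /(_ isT erefl).
rewrite -!powRrM mulVf ?gt_eqF// divff ?gt_eqF// !powRr1//.
rewrite -(ler_pM2l alpha_gt0) => /le_trans; apply.
rewrite le_eqVlt; apply/orP; left; apply/eqP; field.
by rewrite gt_eqF.
Qed.

Lemma job_energyE (w s : R) (l := w * ((alpha - 1) / s) `^ alpha^-1) :
  0 < w -> 0 < s -> l * (w / l) `^ alpha = l * (s / (alpha - 1)).
Proof.
move=> w0 s0; congr (_ * _); rewrite /l.
have a10 : 0 < (alpha - 1) / s by rewrite divr_gt0// subr_gt0.
rewrite invfM mulrA divff ?gt_eqF// mul1r -powRN -powRrM mulNr.
by rewrite mulVf ?gt_eqF// powR_inv1 ?ltW// invf_div.
Qed.

Lemma job_energy_tangent (w s t : R)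
    (l := fun s => w * ((alpha - 1) / s) `^ alpha^-1) :
  0 < w -> 0 < s -> 0 < t ->
  alpha * (l t * (t / (alpha - 1))) <=
  (t - s) * l s + alpha * (l s * (s / (alpha - 1))).
Proof.
move=> w0 s0 t0; rewrite /l.
have a10 : 0 < alpha - 1 by rewrite subr_gt0.
have cE u : 0 < u -> ((alpha - 1) / u) `^ alpha^-1
    = (alpha - 1) `^ alpha^-1 / u `^ alpha^-1.
  by move=> u0; rewrite powRM ?invr_ge0 ?ltW// -(powR_inv1 (ltW u0)) -powRrM
    mulN1r powRN.
rewrite !cE//.
have := weighted_AMGM (ltW s0) (ltW t0).
rewrite powRB; last by rewrite (gt_eqF t0) implybT.
rewrite powRr1 ?(ltW t0)//.
set c := (alpha - 1) `^ _; set S := s `^ _; set T := t `^ _ => amgm.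
have c0 : 0 < c by exact: powR_gt0.
have S0 : 0 < S by exact: powR_gt0.
have T0 : 0 < T by exact: powR_gt0.
(* Scaling by this factor turns the AM-GM bound into exactly the tangent inequality. *)
have k0 : 0 <= w * c / (S * (alpha - 1)).
  by rewrite divr_ge0 ?mulr_ge0 ?ltW// mulr_gt0.
have := ler_wpM2l k0 amgm.
set lhs := (X in X <= _ -> _); set rhs := (X in _ <= X -> _) => le_lr.
have -> : alpha * (w * (c / T) * (t / (alpha - 1))) = lhs.
  by rewrite /lhs; field; rewrite !gt_eqF.
have -> // : (t - s) * (w * (c / S)) + alpha * (w * (c / S) * (s / (alpha - 1)))
   = rhs.
by rewrite /rhs; field; rewrite !gt_eqF.
Qed.

End JobEnergy.

Section Mechanism.
Variables (R : realType) (alpha : R) (n : nat) (w : 'I_n -> R) (sigma : 'S_n).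
Implicit Types (A : {set 'I_n}) (p q : 'I_n -> R) (i j : 'I_n).

Lemma eq_job_length A q1 q2 j :
  (forall m, m \in A -> (sigma j <= sigma m)%N -> q1 m = q2 m) ->
  job_length alpha w sigma A q1 j = job_length alpha w sigma A q2 j.
Proof.
move=> eq_q; rewrite /job_length; congr (_ * (_ / _) `^ _).
by apply: eq_bigr => m /andP[]; exact: eq_q.
Qed.

Lemma eq_OPT A q1 q2 : {in A, q1 =1 q2} ->
  OPT alpha w sigma A q1 = OPT alpha w sigma A q2.
Proof.
move=> eq_q; apply: eq_bigr => j _; rewrite /job_speed (@eq_job_length _ _ q2)//.
by move=> m mA _; exact: eq_q.
Qed.

(** Groups the cost by job, so that two declarations can be compared one job at a time. *)
Lemma player_costE p q i : player_cost alpha w sigma p q i =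
  \sum_j ((if (sigma j <= sigma i)%N
           then (p i - q i) * job_length alpha w sigma [set: 'I_n] q j else 0)
          + alpha * (job_length alpha w sigma [set: 'I_n] q j
                     * job_speed alpha w sigma [set: 'I_n] q j `^ alpha))
  - alpha * OPT alpha w sigma [set~ i] q.
Proof.
rewrite /player_cost /player_charge big_split/= -big_mkcond/= -!mulr_sumr.
have -> : completion_time alpha w sigma [set: 'I_n] q i =
    \sum_(j | (sigma j <= sigma i)%N) job_length alpha w sigma [set: 'I_n] q j.
  by apply: eq_bigl => j; rewrite inE.
have -> : OPT alpha w sigma [set: 'I_n] q =
    \sum_j job_length alpha w sigma [set: 'I_n] q j
           * job_speed alpha w sigma [set: 'I_n] q j `^ alpha.
  by apply: eq_bigl => j; rewrite inE.
by ring.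
Qed.

Lemma sum_with i j q x : (sigma j <= sigma i)%N ->
  \sum_(m in [set: 'I_n] | (sigma j <= sigma m)%N) [eta q with i |-> x] m =
  x + \sum_(m | (sigma j <= sigma m)%N && (m != i)) q m.
Proof.
move=> le_ji; rewrite (bigD1 i)/= ?inE ?le_ji// eqxx; congr (_ + _).
apply: eq_big => [m|m /andP[_ /negPf ->]//]; by rewrite inE.
Qed.

End Mechanism.

Theorem theorem2 (R : realType) (alpha : R) (halpha : 2 <= alpha <= 3)
  (n : nat) (w p : 'I_n -> R)
  (hw : forall j, 0 < w j) (hp : forall j, 0 < p j) (sigma : 'S_n) :
  forall (i : 'I_n) (q : 'I_n -> R), (forall j, j != i -> 0 < q j) ->
  forall x : R, 0 < x ->
    player_cost alpha w sigma p [eta q with i |-> p i] i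
      <= player_cost alpha w sigma p [eta q with i |-> x] i.
Proof.
move=> i q q_gt0 x x0.
have alpha_gt1 : 1 < alpha by lra.
rewrite !player_costE.
rewrite (@eq_OPT _ _ _ _ _ [set~ i] _ [eta q with i |-> x]); last first.
  by move=> j; rewrite !inE /= => /negPf ->.
(* The energy without [i] is the same on both sides and cancels; under truthful declaration the
   coefficient of the length vanishes. *)
rewrite lerD2r; apply: ler_sum => j _; rewrite /= eqxx subrr mul0r.
(* A job after [i] has a length independent of what [i] declares. *)
case: leqP => [le_ji|lt_ij]; last first.
  rewrite /job_speed (@eq_job_length _ _ _ _ _ _ _ [eta q with i |-> x])// => m _.
  by rewrite /=; case: eqP => // ->; rewrite leqNgt lt_ij.
(* Only nonnegative: the sum is empty when [i] is last and [j] is [i]. *)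
have T0 : 0 <= \sum_(m | (sigma j <= sigma m)%N && (m != i)) q m.
  by apply: sumr_ge0 => m /andP[_ /q_gt0 /ltW].
rewrite add0r /job_speed /job_length !sum_with//.
set T := \sum_(m | _) _ in T0 *.
have xT0 : 0 < x + T by exact: ltr_wpDr.
have pT0 : 0 < p i + T by exact: ltr_wpDr.
rewrite !job_energyE//.
have -> : p i - x = (p i + T) - (x + T) by ring.
exact: job_energy_tangent.
Qed.
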